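(* For any integer $n\geq 1$, the identity $$\sum_{k=1}^\infty\frac{(2t)^{2k}}{\binom{2k}{k}k(2k+m)} =\frac{\binom{m}{m/2}}{(2t)^{m}}\left((\arcsin t)^2 -\sqrt{1-t^2}\,\arcsin t\sum_{j=0}^{\frac{m-2}{2}}\frac{(2t)^{2j+1}}{\binom{2j}{j}(2j+1)} +\frac{1}{2}\sum_{j=1}^{\frac{m}{2}}\frac{(2t)^{2j}}{\binom{2j}{j}j^2}\right),$$ taken with the even index $m=2n-2\geq 0$ and real $t$ with $0<|t|<1$, is equivalent to $$(2n-1)\,{}_3F_2\bigl(1,1,n;\tfrac{3}{2},n+1;x\bigr) +{}_3F_2\bigl(1,n,n;n+\tfrac{1}{2},n+1;x\bigr) =2n\,{}_2F_1\bigl(\tfrac{1}{2},1;\tfrac{3}{2};\tfrac{x}{x-1}\bigr)\,{}_2F_1\bigl(1,n;n+\tfrac{1}{2};x\bigr),$$ where $x=t^2$.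
   Context: The generalized hypergeometric function is defined by the power series ${}_pF_q(a_1,\ldots,a_p;b_1,\ldots,b_q;z)=\sum_{k=0}^\infty\frac{(a_1)_k\cdots(a_p)_k}{(b_1)_k\cdots(b_q)_k}\frac{z^k}{k!}$ (and, as usual, by analytic continuation where the argument lies outside the unit disc), with $(a)_0=1$ and $(a)_k=a(a+1)\cdots(a+k-1)$ for $k\ge1$. Empty sums are equal to $0$. *)

(* Defs.v *)
From Stdlib Require Import Reals Arith List ClassicalEpsilon.
From Coquelicot Require Import Coquelicot.
Import ListNotations.
Open Scope R_scope.

(** The sum of [f j] over [lo <= j < hi], which is [0] when [hi <= lo]. *)
Definition sum_range (f : nat -> R) (lo hi : nat) : R :=
  fold_right Rplus 0 (map f (seq lo (hi - lo))).

Fixpoint pochhammer (a : C) (k : nat) : C :=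
  match k with
  | O => RtoC 1
  | S j => (pochhammer a j * (a + RtoC (INR j)))%C
  end.

Definition pochhammer_prod (l : list C) (k : nat) : C :=
  fold_right Cmult (RtoC 1) (map (fun a => pochhammer a k) l).

Definition pFq_coef (a b : list C) (k : nat) : C :=
  (pochhammer_prod a k / (pochhammer_prod b k * RtoC (INR (fact k))))%C.

Definition is_complex_pseries (c : nat -> C) (z w : C) : Prop :=
  @is_pseries C_AbsRing C_NormedModule c z w.

Definition analytic_at (F : C -> C) (z0 : C) : Prop :=
  exists (c : nat -> C) (r : R), 0 < r /\
    forall z : C, Cmod (z - z0)%C < r -> is_complex_pseries c (z - z0)%C (F z).

(** The plane cut along the real half-line from [1] to infinity: the usual
    domain of the principal branch of [q+1]F[q]. *)
Definition slit_plane (z : C) : Prop := ~ (Im z = 0 /\ 1 <= Re z).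

Definition pFq_continuation (a b : list C) (F : C -> C) : Prop :=
  (forall z : C, Cmod z < 1 -> is_complex_pseries (pFq_coef a b) z (F z)) /\
  (forall z : C, slit_plane z -> analytic_at F z).

(** The slit plane is connected, so any two continuations agree on it and
    there is at most one value [w]. *)
Definition pFq_value (a b : list C) (z w : C) : Prop :=
  is_complex_pseries (pFq_coef a b) z w \/
  ((forall v : C, ~ is_complex_pseries (pFq_coef a b) z v) /\
   slit_plane z /\
   exists F : C -> C, pFq_continuation a b F /\ F z = w).

(** Unspecified where no value exists, for example where the series diverges
    on the cut. *)
Definition pFq (a b : list C) (z : C) : C :=
  epsilon (inhabits (RtoC 0)) (pFq_value a b z).

Definition hyp2F1 (a1 a2 b1 z : C) : C := pFq [a1; a2] [b1] z.

Definition hyp3F2 (a1 a2 a3 b1 b2 z : C) : C := pFq [a1; a2; a3] [b1; b2] z.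

(* Main.v *)
(** Put [x = t^2] and [a_k = k! / (3/2)_k].  The power series of
    [asin t / (t sqrt (1 - t^2))] and of [(asin t)^2] are [sum a_k x^k] and
    [sum a_k x^(k+1) / (k+1)]: the recurrence for [a_k] gives a first-order
    differential equation for the former.  The functions [2F1(1,n;n+1/2;x)] and
    [3F2(1,n,n;n+1/2,n+1;x)] are rescaled tails of these two series, because
    [(n)_k / (n+1/2)_k = a_(n-1+k) / a_(n-1)], and [1 / binom(2k,k)] is again
    a multiple of [a_k]; so [3F2(1,1,n;3/2,n+1;x)] is [n / x] times the series on the
    left-hand side.  After these substitutions the hypergeometric identity is
    a nonzero multiple of the evaluation of that series.

    The argument [x / (x - 1)] leaves the unit disc when [x > 1/2].  There the
    continuation of [2F1(1/2,1;3/2;z)] is the integral of [1 / (1 - z s^2)]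
    over [0 <= s <= 1], expanded around any point of the slit plane by a
    geometric series; the identity theorem along the negative axis makes its
    value the only possible one. *)
Require Import Defs.
From Stdlib Require Import Reals Arith List ClassicalEpsilon Lra Lia.
From Coquelicot Require Import Coquelicot.
Import ListNotations.
Open Scope R_scope.

(** * Complex series through real and imaginary parts *)

Lemma Re_sum_n (u : nat -> C_NormedModule) (n : nat) :
  Re (sum_n u n) = sum_n (fun k => Re (u k)) n.
Proof.
  induction n as [|n IH].
  - now rewrite !sum_O.
  - rewrite !sum_Sn, <- IH. reflexivity.
Qed.

Lemma Im_sum_n (u : nat -> C_NormedModule) (n : nat) :
  Im (sum_n u n) = sum_n (fun k => Im (u k)) n.
Proof.
  induction n as [|n IH].
  - now rewrite !sum_O.
  - rewrite !sum_Sn, <- IH. reflexivity.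
Qed.

(** The balls of [C_UniformSpace] are products of real balls, so convergence in [C] splits into its
    two components. *)
Lemma is_series_C (u : nat -> C_NormedModule) (l : C) :
  is_series u l <->
  is_series (fun k => Re (u k)) (Re l) /\ is_series (fun k => Im (u k)) (Im l).
Proof.
  unfold is_series. split.
  - intros H. pose proof (proj1 (filterlim_locally (U := C_UniformSpace) _ _) H) as H'.
    clear H; rename H' into H.
    split; apply filterlim_locally; intros eps;
      generalize (H eps); apply filter_imp; intros n [H1 H2].
    + rewrite <- Re_sum_n. exact H1.
    + rewrite <- Im_sum_n. exact H2.
  - intros [H1 H2].
    pose proof (proj1 (filterlim_locally (U := R_UniformSpace) _ _) H1) as K1.
    pose proof (proj1 (filterlim_locally (U := R_UniformSpace) _ _) H2) as K2.
    apply (proj2 (filterlim_locally (U := C_UniformSpace) _ _)); intros eps.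
    generalize (filter_and _ _ (K1 eps) (K2 eps)). apply filter_imp.
    intros n [L1 L2]. rewrite <- Re_sum_n in L1. rewrite <- Im_sum_n in L2.
    now split.
Qed.

Lemma is_series_C_unique (u : nat -> C_NormedModule) (l1 l2 : C) :
  is_series u l1 -> is_series u l2 -> l1 = l2.
Proof.
  rewrite !is_series_C. intros [H1 H2] [H3 H4].
  apply is_series_unique in H1, H2, H3, H4.
  rewrite (surjective_pairing l1), (surjective_pairing l2).
  unfold Re, Im in *. congruence.
Qed.

Lemma pow_n_RtoC (x : R) (k : nat) :
  @pow_n C_Ring (RtoC x) k = RtoC (x ^ k).
Proof.
  induction k as [|k IH]; [reflexivity|].
  change (RtoC x * @pow_n C_Ring (RtoC x) k = RtoC (x * x ^ k))%C.
  now rewrite IH, RtoC_mult.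
Qed.

(** Powers of a real argument are real, so the components of the coefficients never mix; real power
    series theory then applies to each. *)
Lemma is_complex_pseries_real_arg (c : nat -> C) (x : R) (w : C) :
  is_complex_pseries c (RtoC x) w <->
  is_pseries (fun k => Re (c k)) x (Re w) /\
  is_pseries (fun k => Im (c k)) x (Im w).
Proof.
  unfold is_complex_pseries, is_pseries. rewrite is_series_C.
  assert (E : forall k, @scal C_AbsRing C_NormedModule (@pow_n C_AbsRing (RtoC x) k) (c k)
              = (pow_n x k * Re (c k), pow_n x k * Im (c k))).
  { intros k. change (@pow_n C_AbsRing (RtoC x) k) with (@pow_n C_Ring (RtoC x) k).
    rewrite pow_n_RtoC, <- pow_n_pow. generalize (@pow_n R_Ring x k). intros p.
    change (Cmult (RtoC p) (c k) = (Rmult p (Re (c k)), Rmult p (Im (c k)))).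
    apply injective_projections; unfold Re, Im; simpl; ring. }
  split; intros [H1 H2]; split.
  - revert H1. apply is_series_ext. intros k. now rewrite E.
  - revert H2. apply is_series_ext. intros k. now rewrite E.
  - revert H1. apply is_series_ext. intros k. now rewrite E.
  - revert H2. apply is_series_ext. intros k. now rewrite E.
Qed.

Lemma is_complex_pseries_RtoC (c : nat -> R) (x l : R) :
  is_pseries c x l -> is_complex_pseries (fun k => RtoC (c k)) (RtoC x) (RtoC l).
Proof.
  intros H. apply is_complex_pseries_real_arg. split; simpl; [exact H|].
  apply is_pseries_R. apply is_series_ext with (fun _ => 0).
  { intros k. simpl. ring. }
  apply filterlim_locally. intros eps. exists 0%nat. intros n _.
  rewrite sum_n_const, Rmult_0_r. apply ball_center.
Qed.

(** * Euler's integral of 2F1(1/2,1;3/2;z), with integrand [kernel z] after the substitution u =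
    s^2 *)

Definition kernel (z : C) (s : R) : C := (/ (1 - z * RtoC (s ^ 2)))%C.

(** Taken componentwise, so that the real theory of [RInt] supplies existence, linearity and
    bounds. *)
Definition int01 (f : R -> C) : C :=
  (RInt (fun s => Re (f s)) 0 1, RInt (fun s => Im (f s)) 0 1).

Definition cont01 (f : R -> C) : Prop :=
  forall s, 0 <= s <= 1 ->
    continuous (fun s => Re (f s)) s /\ continuous (fun s => Im (f s)) s.

Lemma cont01_mult (f g : R -> C) :
  cont01 f -> cont01 g -> cont01 (fun s => f s * g s)%C.
Proof.
  intros Hf Hg s Hs. destruct (Hf s Hs) as [F1 F2], (Hg s Hs) as [G1 G2]. split.
  - apply (continuous_minus (fun s => Re (f s) * Re (g s)) (fun s => Im (f s) * Im (g s)));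
      now apply (continuous_mult (K := R_AbsRing)).
  - apply (continuous_plus (fun s => Re (f s) * Im (g s)) (fun s => Im (f s) * Re (g s)));
      now apply (continuous_mult (K := R_AbsRing)).
Qed.

Lemma cont01_const (c : C) : cont01 (fun _ => c).
Proof. intros s _. split; apply continuous_const. Qed.

Lemma cont01_pow (f : R -> C) (k : nat) :
  cont01 f -> cont01 (fun s => @pow_n C_Ring (f s) k).
Proof.
  intros Hf. induction k as [|k IH].
  - apply (cont01_const 1).
  - apply (cont01_mult f (fun s => @pow_n C_Ring (f s) k) Hf IH).
Qed.

Lemma cont01_real (f : R -> R) :
  (forall s, continuous f s) -> cont01 (fun s => RtoC (f s)).
Proof. intros Hf s _. split; [apply Hf | apply continuous_const]. Qed.

Lemma continuous_sqr (s : R) : continuous (fun s => s ^ 2) s.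
Proof.
  apply (ex_derive_continuous (fun s => s ^ 2)). auto_derive. exact I.
Qed.

Lemma cont01_kernel (z : C) :
  (forall s, 0 <= s <= 1 -> (1 - z * RtoC (s ^ 2))%C <> 0) -> cont01 (kernel z).
Proof.
  intros Hz s Hs. specialize (Hz s Hs).
  (* This is the squared modulus of 1 - z s^2, the denominator of both components of [Cinv]. *)
  assert (D : (1 - fst z * s ^ 2) ^ 2 + (snd z * s ^ 2) ^ 2 <> 0).
  { intros D. apply Hz.
    assert (D1 : 1 - fst z * s ^ 2 = 0) by nra.
    assert (D2 : snd z * s ^ 2 = 0) by nra.
    apply injective_projections; unfold RtoC; simpl in *; lra. }
  split; unfold kernel, Cinv, Re, Im; simpl.
  - apply (ex_derive_continuous (V := R_NormedModule)). auto_derive.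
    intros E. apply D. rewrite <- E. simpl. ring.
  - apply (ex_derive_continuous (V := R_NormedModule)). auto_derive.
    intros E. apply D. rewrite <- E. simpl. ring.
Qed.

Lemma cont01_ex_RInt (f : R -> C) :
  cont01 f -> ex_RInt (fun s => Re (f s)) 0 1 /\ ex_RInt (fun s => Im (f s)) 0 1.
Proof.
  intros Hf. split; apply (ex_RInt_continuous (V := R_CompleteNormedModule));
    intros s Hs; rewrite Rmin_left, Rmax_right in Hs by lra; now apply Hf.
Qed.

Lemma int01_ext (f g : R -> C) :
  (forall s, 0 <= s <= 1 -> f s = g s) -> int01 f = int01 g.
Proof.
  intros H. unfold int01. f_equal; apply RInt_ext; intros s Hs;
    rewrite Rmin_left, Rmax_right in Hs by lra; rewrite H; auto; lra.
Qed.

Lemma int01_scal (c : C) (f : R -> C) :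
  cont01 f -> int01 (fun s => c * f s)%C = (c * int01 f)%C.
Proof.
  intros Hf. destruct (cont01_ex_RInt f Hf) as [H1 H2].
  apply (RInt_correct (V := R_CompleteNormedModule)) in H1, H2.
  unfold int01. apply injective_projections; cbn [fst snd Cmult].
  - apply is_RInt_unique.
    apply (is_RInt_minus (V := R_NormedModule) (fun s => fst c * Re (f s)) (fun s => snd c * Im (f s)));
      now apply (is_RInt_scal (V := R_NormedModule)).
  - apply is_RInt_unique.
    apply (is_RInt_plus (V := R_NormedModule) (fun s => fst c * Im (f s)) (fun s => snd c * Re (f s)));
      now apply (is_RInt_scal (V := R_NormedModule)).
Qed.

Lemma int01_minus (f g : R -> C) :
  cont01 f -> cont01 g ->
  int01 (fun s => f s - g s)%C = (int01 f - int01 g)%C.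
Proof.
  intros Hf Hg. destruct (cont01_ex_RInt f Hf) as [H1 H2].
  destruct (cont01_ex_RInt g Hg) as [H3 H4].
  unfold int01. apply injective_projections; simpl.
  - now apply (RInt_minus (V := R_CompleteNormedModule)
      (fun s => Re (f s)) (fun s => Re (g s))).
  - now apply (RInt_minus (V := R_CompleteNormedModule)
      (fun s => Im (f s)) (fun s => Im (g s))).
Qed.

(** Each component is at most the modulus in absolute value and the interval has length 1. Bounding
    the components separately is enough to make a remainder tend to 0. *)
Lemma int01_bound (f : R -> C) (M : R) :
  cont01 f -> (forall s, 0 <= s <= 1 -> Cmod (f s) <= M) ->
  Rabs (Re (int01 f)) <= M /\ Rabs (Im (int01 f)) <= M.
Proof.
  intros Hf HM. destruct (cont01_ex_RInt f Hf) as [H1 H2].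
  unfold int01, Re at 1, Im at 1; simpl.
  replace M with ((1 - 0) * M) by ring.
  split; (apply abs_RInt_le_const; [lra | assumption |]); intros s Hs;
    refine (Rle_trans _ _ _ _ (HM s Hs));
    (eapply Rle_trans; [| apply Rmax_Cmod]); [apply Rmax_l | apply Rmax_r].
Qed.

(** The Taylor coefficients at [z0] of the integral: with K = 1/(1 - z0 s^2), the integrand expands
    as the sum of (z - z0)^k K (s^2 K)^k, integrated term by term. *)
Definition kernel_coef (z0 : C) (k : nat) : C :=
  int01 (fun s => kernel z0 s * @pow_n C_Ring (RtoC (s ^ 2) * kernel z0 s) k)%C.

(** The resolvent identity: the reciprocals of the two kernels differ by (z - z0) s^2. It is one
    step of the geometric series. *)
Lemma kernel_geometric (z0 z : C) (s : R) :
  (1 - z0 * RtoC (s ^ 2))%C <> 0 -> (1 - z * RtoC (s ^ 2))%C <> 0 ->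
  (kernel z s - (z - z0) * (RtoC (s ^ 2) * kernel z0 s) * kernel z s = kernel z0 s)%C.
Proof.
  intros H0 H. unfold kernel. field. now split.
Qed.

Lemma Cpow_n_mult (a b : C) (k : nat) :
  (@pow_n C_Ring (a * b) k = @pow_n C_Ring a k * @pow_n C_Ring b k)%C.
Proof.
  induction k as [|k IH].
  - cbn. now rewrite Cmult_1_l.
  - change (a * b * @pow_n C_Ring (a * b) k
            = (a * @pow_n C_Ring a k) * (b * @pow_n C_Ring b k))%C.
    rewrite IH. ring.
Qed.

Lemma Cmod_pow_n (a : C) (k : nat) : Cmod (@pow_n C_Ring a k) = Cmod a ^ k.
Proof.
  induction k as [|k IH].
  - apply Cmod_1.
  - change (Cmod (a * @pow_n C_Ring a k) = Cmod a * Cmod a ^ k).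
    now rewrite Cmod_mult, IH.
Qed.

(** The partial sums telescope. Each application of the resolvent identity turns the k-th term into
    [T k - T (S k)], where [T N] integrates the N-th power of the ratio [q] against [kernel z]. The
    remainder is at most rho^N / d in each component, so no interchange of sum and integral is
    required. *)
Lemma kernel_expansion (z0 z : C) (rho d : R) :
  0 <= rho < 1 -> 0 < d ->
  (forall s, 0 <= s <= 1 -> (1 - z0 * RtoC (s ^ 2))%C <> 0) ->
  (forall s, 0 <= s <= 1 -> d <= Cmod (1 - z * RtoC (s ^ 2))) ->
  (forall s, 0 <= s <= 1 ->
     Cmod ((z - z0) * (RtoC (s ^ 2) * kernel z0 s)) <= rho) ->
  is_complex_pseries (kernel_coef z0) (z - z0)%C (int01 (kernel z)).
Proof.
  intros Hrho Hd Hz0 Hz Hq.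
  assert (Hz' : forall s, 0 <= s <= 1 -> (1 - z * RtoC (s ^ 2))%C <> 0).
  { intros s Hs E. specialize (Hz s Hs). rewrite E, Cmod_0 in Hz. lra. }
  set (q := fun s => ((z - z0) * (RtoC (s ^ 2) * kernel z0 s))%C).
  set (g := fun s => (RtoC (s ^ 2) * kernel z0 s)%C).
  set (T := fun N => int01 (fun s => @pow_n C_Ring (q s) N * kernel z s)%C).
  assert (Ck0 := cont01_kernel z0 Hz0). assert (Ck := cont01_kernel z Hz').
  assert (Cg : cont01 g).
  { apply cont01_mult; [|exact Ck0]. apply cont01_real, continuous_sqr. }
  assert (Cq : cont01 q) by (apply cont01_mult; [apply cont01_const | exact Cg]).
  assert (CT : forall N, cont01 (fun s => @pow_n C_Ring (q s) N * kernel z s)%C).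
  { intros N. apply cont01_mult; [now apply cont01_pow | exact Ck]. }
  assert (HT0 : T 0%nat = int01 (kernel z)).
  { apply int01_ext. intros s _. apply Cmult_1_l. }
  assert (HTS : forall N, (@pow_n C_Ring (z - z0) N * kernel_coef z0 N = T N - T (S N))%C).
  { intros N. unfold kernel_coef, T.
    rewrite <- int01_scal.
    2:{ apply cont01_mult; [exact Ck0 | now apply (cont01_pow g)]. }
    rewrite <- int01_minus by apply CT.
    apply int01_ext. intros s Hs.
    rewrite <- (kernel_geometric z0 z s (Hz0 s Hs) (Hz' s Hs)) at 1.
    change (@pow_n C_Ring (q s) (S N)) with (q s * @pow_n C_Ring (q s) N)%C.
    unfold q at 1 3. fold (g s). rewrite Cpow_n_mult.
    set (u := @pow_n C_Ring (z - z0)%C N : C). set (v := @pow_n C_Ring (g s) N : C).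
    change ((u * ((kernel z s - (z - z0) * g s * kernel z s) * v)
      = u * v * kernel z s - (z - z0) * g s * (u * v) * kernel z s)%C). ring. }
  assert (HTlim : forall N, Rabs (Re (T N)) <= / d * rho ^ N
                       /\ Rabs (Im (T N)) <= / d * rho ^ N).
  { intros N. apply int01_bound; [apply CT|]. intros s Hs.
    rewrite Cmod_mult, Cmod_pow_n. rewrite Rmult_comm.
    apply Rmult_le_compat; try apply Cmod_ge_0.
    - apply pow_le, Cmod_ge_0.
    - unfold kernel. rewrite Cmod_inv by now apply Hz'.
      apply Rinv_le_contravar; [exact Hd | now apply Hz].
    - apply pow_incr. split; [apply Cmod_ge_0 | now apply Hq]. }
  unfold is_complex_pseries, is_pseries.
  assert (Hsum : forall N, @sum_n C_AbelianMonoid (fun k => (@pow_n C_Ring (z - z0) k * kernel_coef z0 k)%C) N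
                   = (T 0%nat - T (S N))%C).
  { induction N as [|N IH].
    - rewrite sum_O. apply HTS.
    - rewrite sum_Sn, IH, HTS. change plus with Cplus. cbn. ring. }
  assert (Hgeom : is_lim_seq (fun N => / d * rho ^ S N) 0).
  { replace (Finite 0) with (Rbar_mult (/ d) 0) by (simpl; f_equal; ring).
    apply (is_lim_seq_scal_l (fun N => rho ^ S N)).
    apply (is_lim_seq_incr_1 (fun N => rho ^ N)). apply is_lim_seq_geom.
    rewrite Rabs_right; lra. }
  unfold is_series. apply filterlim_locally. intros eps.
  rewrite <- HT0.
  apply is_lim_seq_spec in Hgeom. generalize (Hgeom eps). apply filter_imp.
  intros N HN. rewrite Rminus_0_r in HN. apply Rabs_lt_between in HN.
  destruct (HTlim (S N)) as [K1 K2].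
  change (@ball C_UniformSpace (T 0%nat) eps (@sum_n C_AbelianMonoid (fun k => (@pow_n C_Ring (z - z0) k * kernel_coef z0 k)%C) N)).
  rewrite Hsum.
  split.
  - change (Rabs (Re (T 0%nat) + - Re (T (S N)) + - Re (T 0%nat)) < eps).
    replace (Re (T 0%nat) + - Re (T (S N)) + - Re (T 0%nat)) with (- Re (T (S N)))
      by ring. rewrite Rabs_Ropp. lra.
  - change (Rabs (Im (T 0%nat) + - Im (T (S N)) + - Im (T 0%nat)) < eps).
    replace (Im (T 0%nat) + - Im (T (S N)) + - Im (T 0%nat)) with (- Im (T (S N)))
      by ring. rewrite Rabs_Ropp. lra.
Qed.

(** By compactness the squared modulus of 1 - z s^2 attains its minimum on [0,1]; were it 0 at s0,
    then z = 1/s0^2 would be real and at least 1, on the cut. *)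
Lemma slit_plane_kernel_bound (z : C) :
  slit_plane z ->
  exists d, 0 < d /\ forall s, 0 <= s <= 1 -> d <= Cmod (1 - z * RtoC (s ^ 2)).
Proof.
  intros Hz.
  set (f := fun s => (1 - Re z * s ^ 2) ^ 2 + (Im z * s ^ 2) ^ 2).
  assert (Ef : forall s, Cmod (1 - z * RtoC (s ^ 2)) = sqrt (f s)).
  { intros s. unfold Cmod, f, Re, Im. f_equal. simpl. ring. }
  destruct (continuity_ab_min f 0 1) as [s0 [Hmin Hs0]]; [lra | |].
  { intros c _. apply continuity_pt_filterlim.
    apply (ex_derive_continuous (V := R_NormedModule)). unfold f. auto_derive. exact I. }
  exists (sqrt (f s0)). split.
  - apply sqrt_lt_R0. destruct (Rle_lt_dec (f s0) 0) as [H|H]; [exfalso|exact H].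
    unfold f in H.
    destruct (Rplus_sqr_eq_0 (1 - Re z * s0 ^ 2) (Im z * s0 ^ 2)) as [H1 H2].
    { pose proof (pow2_ge_0 (1 - Re z * s0 ^ 2)). pose proof (pow2_ge_0 (Im z * s0 ^ 2)).
      unfold Rsqr. lra. }
    apply Hz. assert (0 <= s0 ^ 2 <= 1) by nra.
    assert (s0 ^ 2 <> 0) by (intros E; rewrite E in H1; lra). split; nra.
  - intros s Hs. rewrite Ef. apply sqrt_le_1_alt. now apply Hmin.
Qed.

(** Within distance d/2 of [z0] the modulus of 1 - z s^2 drops by at most d/2 from its lower bound
    d, and the geometric ratio is at most (d/2)/d = 1/2. *)
Lemma int01_kernel_analytic (z0 : C) :
  slit_plane z0 -> analytic_at (fun z => int01 (kernel z)) z0.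
Proof.
  intros H0. destruct (slit_plane_kernel_bound z0 H0) as [d [Hd Hb]].
  exists (kernel_coef z0), (d / 2). split; [lra|].
  intros z Hz.
  assert (Hnz : forall s, 0 <= s <= 1 -> (1 - z0 * RtoC (s ^ 2))%C <> 0).
  { intros s Hs E. specialize (Hb s Hs). rewrite E, Cmod_0 in Hb. lra. }
  assert (Hs2 : forall s, 0 <= s <= 1 -> Cmod (RtoC (s ^ 2)) <= 1).
  { intros s Hs. rewrite Cmod_R, Rabs_right; nra. }
  assert (Hp : forall s, 0 <= s <= 1 -> Cmod ((z - z0) * RtoC (s ^ 2)) <= d / 2).
  { intros s Hs. rewrite Cmod_mult. specialize (Hs2 s Hs).
    pose proof (Cmod_ge_0 (z - z0)). pose proof (Cmod_ge_0 (RtoC (s ^ 2))). nra. }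
  apply (kernel_expansion z0 z (1 / 2) (d / 2)); [lra | lra | exact Hnz | |].
  - intros s Hs. specialize (Hb s Hs). specialize (Hp s Hs).
    replace (1 - z0 * RtoC (s ^ 2))%C
      with ((1 - z * RtoC (s ^ 2)) + (z - z0) * RtoC (s ^ 2))%C in Hb by ring.
    pose proof (Cmod_triangle (1 - z * RtoC (s ^ 2)) ((z - z0) * RtoC (s ^ 2))). lra.
  - intros s Hs. specialize (Hb s Hs). specialize (Hp s Hs).
    rewrite Cmult_assoc, Cmod_mult. unfold kernel. rewrite Cmod_inv by now apply Hnz.
    apply Rle_div_l; [lra|]. lra.
Qed.

Lemma kernel_coef_0 (k : nat) : kernel_coef 0 k = RtoC (/ (2 * INR k + 1)).
Proof.
  assert (E : forall s, (kernel 0 s * @pow_n C_Ring (RtoC (s ^ 2) * kernel 0 s) k)%C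
                        = RtoC (s ^ (2 * k))).
  { intros s. replace (kernel 0 s) with (RtoC 1).
    2:{ unfold kernel. field. }
    rewrite Cmult_1_r, pow_n_RtoC, Cmult_1_l. now rewrite pow_mult. }
  assert (Hk : 0 <= INR k) by apply pos_INR.
  unfold kernel_coef, int01. apply injective_projections; cbn [fst snd RtoC].
  - apply is_RInt_unique.
    apply (is_RInt_ext (fun s => s ^ (2 * k))).
    { intros s _. now rewrite E. }
    replace (/ (2 * INR k + 1)) with (minus (1 ^ S (2 * k) / (2 * INR k + 1)) (0 ^ S (2 * k) / (2 * INR k + 1))).
    2:{ rewrite pow1, pow_i by lia. unfold minus, plus, opp; simpl. field. lra. }
    apply (is_RInt_derive (V := R_CompleteNormedModule) (fun s => s ^ S (2 * k) / (2 * INR k + 1))).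
    + intros s _. auto_derive; [exact I|].
      rewrite Nat.add_0_r. replace (INR (k + k)) with (2 * INR k) by (rewrite plus_INR; ring).
      replace (k + k)%nat with (2 * k)%nat by lia.
      (* The factor [INR (S (2 * k))] of the derivative appears unfolded, as a case distinction on
         whether 2k is 0. *)
      replace (match (2 * k)%nat with 0%nat => 1 | S _ => 2 * INR k + 1 end) with (2 * INR k + 1).
      2:{ destruct k as [|k]; [simpl; lra | reflexivity]. }
      field. lra.
    + intros s _. apply (ex_derive_continuous (V := R_NormedModule)). auto_derive. exact I.
  - transitivity (RInt (fun _ => 0) 0 1).
    + apply RInt_ext. intros s _. now rewrite E.
    + rewrite RInt_const. apply Rmult_0_r.
Qed.

(** At the centre 0 the ratio is z s^2, of modulus at most |z|, so the expansion reaches the whole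
    unit disc and not just the half radius of the general estimate. *)
Lemma int01_kernel_series (z : C) :
  Cmod z < 1 ->
  is_complex_pseries (fun k => RtoC (/ (2 * INR k + 1))) z (int01 (kernel z)).
Proof.
  intros Hz. pose proof (Cmod_ge_0 z) as Hz0.
  assert (Hs2 : forall s, 0 <= s <= 1 -> Cmod (z * RtoC (s ^ 2)) <= Cmod z).
  { intros s Hs. assert (0 <= s ^ 2 <= 1) by nra.
    rewrite Cmod_mult, Cmod_R, Rabs_right by lra. nra. }
  assert (K : is_complex_pseries (kernel_coef 0) (z - 0)%C (int01 (kernel z))).
  { apply (kernel_expansion 0 z (Cmod z) (1 - Cmod z)); [lra | lra | | |].
    - intros s _ E. rewrite Cmult_0_l in E. apply (f_equal fst) in E. simpl in E. lra.
    - intros s Hs. specialize (Hs2 s Hs).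
      pose proof (Cmod_triangle (1 - z * RtoC (s ^ 2)) (z * RtoC (s ^ 2))) as T.
      replace (1 - z * RtoC (s ^ 2) + z * RtoC (s ^ 2))%C with (RtoC 1) in T by ring.
      rewrite Cmod_1 in T. lra.
    - intros s Hs. unfold kernel.
      replace ((z - 0) * (RtoC (s ^ 2) * / (1 - 0 * RtoC (s ^ 2))))%C
        with (z * RtoC (s ^ 2))%C by field.
      now apply Hs2. }
  replace (z - 0)%C with z in K by ring.
  revert K. apply is_series_ext. intros k. now rewrite kernel_coef_0.
Qed.

(** Writing the negative argument as -u^2 makes the integrand 1/(1 + (u s)^2), with antiderivative
    atan(u s)/u. *)
Lemma int01_kernel_neg (u : R) :
  u <> 0 -> int01 (kernel (RtoC (- u ^ 2))) = RtoC (atan u / u).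
Proof.
  intros Hu.
  assert (P : forall s, 0 < 1 + (u * s) ^ 2).
  { intros s. pose proof (pow2_ge_0 (u * s)). lra. }
  assert (E : forall s, kernel (RtoC (- u ^ 2)) s = RtoC (/ (1 + (u * s) ^ 2))).
  { intros s. unfold kernel. rewrite <- RtoC_mult, <- RtoC_minus, <- RtoC_inv.
    - do 2 f_equal. ring.
    - specialize (P s). lra. }
  unfold int01. apply injective_projections; cbn [fst snd RtoC].
  - apply is_RInt_unique.
    apply (is_RInt_ext (fun s => / (1 + (u * s) ^ 2))).
    { intros s _. now rewrite E. }
    replace (atan u / u) with (minus (atan (u * 1) / u) (atan (u * 0) / u)).
    2:{ rewrite Rmult_1_r, Rmult_0_r, atan_0. unfold minus, plus, opp; simpl. field. exact Hu. }
    apply (is_RInt_derive (V := R_CompleteNormedModule) (fun s => atan (u * s) / u)).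
    + intros s _. specialize (P s). auto_derive; [exact I|].
      unfold Rsqr. field. split; [nra | exact Hu].
    + intros s _. apply (ex_derive_continuous (V := R_NormedModule)). auto_derive.
      specialize (P s). nra.
  - transitivity (RInt (fun _ => 0) 0 1).
    + apply RInt_ext. intros s _. now rewrite E.
    + rewrite RInt_const. apply Rmult_0_r.
Qed.

(** * The identity theorem along the negative real axis *)

Lemma CV_radius_ge (a : nat -> R) (x : R) :
  ex_pseries a x -> Rbar_le (Rabs x) (CV_radius a).
Proof.
  intros Ha. apply Rbar_not_lt_le. intros Hlt.
  apply (CV_disk_outside a x Hlt).
  apply ex_series_lim_0. destruct Ha as [l Hl]. exists l. now apply is_pseries_R.
Qed.

(** Continuity at 0 kills the constant term; dividing by v > 0 leaves the shifted series, again zero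
    to the right of 0, and induction on the index finishes. *)
Lemma pseries_zero_right (a : nat -> R) (r : R) :
  0 < r -> (forall v, 0 < v < r -> is_pseries a v 0) -> forall n, a n = 0.
Proof.
  intros Hr Ha n.
  assert (Hhead : forall b : nat -> R,
            (forall v, 0 < v < r -> is_pseries b v 0) -> b 0%nat = 0).
  { clear a n Ha. intros a Ha.
    destruct (Req_dec (a 0%nat) 0) as [E|E]; [exact E|exfalso].
    assert (Hc : Rbar_lt (Rabs 0) (CV_radius a)).
    { apply Rbar_lt_le_trans with (Rabs (r / 2)).
      - simpl. rewrite Rabs_R0, Rabs_right; lra.
      - apply CV_radius_ge. exists 0. apply Ha. lra. }
    pose proof (PSeries_continuity a 0 Hc) as Hcont.
    destruct (Hcont (Rabs (a 0%nat)) (Rabs_pos_lt _ E)) as [alp [Halp H]].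
    set (v := Rmin (alp / 2) (r / 2)).
    assert (Hv : 0 < v /\ v < alp /\ v < r).
    { unfold v. pose proof (Rmin_l (alp / 2) (r / 2)). pose proof (Rmin_r (alp / 2) (r / 2)).
      repeat split; try lra. apply Rmin_glb_lt; lra. }
    specialize (H v). simpl in H. unfold Rdist in H.
    rewrite (is_pseries_unique a v 0) in H by (apply Ha; lra).
    rewrite PSeries_0, Rminus_0_l, Rabs_Ropp, Rminus_0_r, (Rabs_right v) in H by lra.
    apply (Rlt_irrefl (Rabs (a 0%nat))), H.
    repeat split; lra. }
  revert a Ha. induction n as [|n IH]; intros a Ha; [now apply Hhead|].
  apply (IH (PS_decr_1 a)). intros v Hv.
  replace 0 with (@scal R_AbsRing R_NormedModule (/ v) (plus 0 (opp (a 0%nat)))).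
  2:{ rewrite (Hhead a Ha). unfold scal, plus, opp; simpl. unfold mult; simpl. ring. }
  apply (is_pseries_decr_1 (K := R_AbsRing) (V := R_NormedModule)); [|now apply Ha].
  change (/ v * v = 1). field. lra.
Qed.

(** Agreement on the right of [x] already forces equal Taylor coefficients, and these carry the
    agreement over to the left. *)
Lemma analytic_eq_right (F G : C -> C) (x : R) (r : R) :
  analytic_at F (RtoC x) -> analytic_at G (RtoC x) -> 0 < r ->
  (forall v, 0 < v < r -> F (RtoC (x + v)) = G (RtoC (x + v))) ->
  exists r', 0 < r' /\
    forall v, Rabs v < r' -> F (RtoC (x + v)) = G (RtoC (x + v)).
Proof.
  intros [c [rF [HrF HF]]] [e [rG [HrG HG]]] Hr Heq.
  set (r' := Rmin rF rG).
  pose proof (Rmin_l rF rG) as HlF. pose proof (Rmin_r rF rG) as HlG. fold r' in HlF, HlG.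
  assert (Hr' : 0 < r') by (unfold r'; apply Rmin_glb_lt; lra).
  assert (Hser : forall v, Rabs v < r' ->
            is_complex_pseries c (RtoC v) (F (RtoC (x + v))) /\
            is_complex_pseries e (RtoC v) (G (RtoC (x + v)))).
  { intros v Hv. specialize (HF (RtoC (x + v))). specialize (HG (RtoC (x + v))).
    rewrite <- RtoC_minus in HF, HG. replace (x + v - x) with v in HF, HG by ring.
    rewrite Cmod_R in HF, HG. split; [apply HF | apply HG]; lra. }
  assert (Hce : forall k, c k = e k).
  { assert (Hdiff : forall (f g : nat -> R) (v l : R),
              is_pseries f v l -> is_pseries g v l ->
              is_pseries (fun k => f k - g k) v 0).
    { intros f g v l Hf Hg. replace 0 with (l - l) by ring.
      now apply (is_pseries_minus (V := R_NormedModule)). }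
    assert (HH : forall v, 0 < v < Rmin r r' ->
              is_pseries (fun k => Re (c k) - Re (e k)) v 0 /\
              is_pseries (fun k => Im (c k) - Im (e k)) v 0).
    { intros v [Hv0 Hv]. pose proof (Rmin_l r r'). pose proof (Rmin_r r r').
      destruct (Hser v) as [H1 H2]; [rewrite Rabs_right; lra|].
      rewrite <- Heq in H2 by lra.
      apply is_complex_pseries_real_arg in H1, H2. split; eapply Hdiff.
      1: exact (proj1 H1). 1: exact (proj1 H2). 1: exact (proj2 H1). exact (proj2 H2). }
    assert (Hm : 0 < Rmin r r') by (apply Rmin_glb_lt; lra).
    intros k. apply injective_projections.
    - apply Rminus_diag_uniq.
      apply (pseries_zero_right _ _ Hm (fun v Hv => proj1 (HH v Hv)) k).
    - apply Rminus_diag_uniq.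
      apply (pseries_zero_right _ _ Hm (fun v Hv => proj2 (HH v Hv)) k). }
  exists r'. split; [exact Hr'|]. intros v Hv. destruct (Hser v Hv) as [H1 H2].
  apply (is_series_C_unique _ _ _ H1).
  revert H2. apply is_series_ext. intros k. now rewrite Hce.
Qed.

Lemma slit_plane_neg (s : R) : 0 <= s -> slit_plane (RtoC (- s)).
Proof. intros Hs [_ H]. simpl in H. lra. Qed.

(** A connectedness argument: let m be the supremum of the s such that F and G agree on [-s,0].
    One-sided agreement at -m spreads to a neighbourhood, which pushes the supremum beyond m. *)
Lemma pFq_continuation_unique_neg (a b : list C) (F G : C -> C) (y : R) :
  pFq_continuation a b F -> pFq_continuation a b G -> 0 <= y ->
  F (RtoC (- y)) = G (RtoC (- y)).
Proof.
  intros [HF1 HF2] [HG1 HG2] Hy.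
  destruct (excluded_middle_informative (F (RtoC (- y)) = G (RtoC (- y)))) as [E|N];
    [exact E | exfalso].
  set (E := fun s => 0 <= s /\ forall s', 0 <= s' <= s -> F (RtoC (- s')) = G (RtoC (- s'))).
  destruct (completeness E) as [m [Hub Hlub]].
  { exists y. intros s [Hs H]. destruct (Rle_lt_dec s y) as [L|L]; [exact L|].
    exfalso. apply N, H. lra. }
  { exists 0. split; [lra|]. intros s' Hs'. apply (is_series_C_unique (fun k =>
      @scal C_AbsRing C_NormedModule (@pow_n C_AbsRing (RtoC (- s')) k) (pFq_coef a b k)));
      [apply HF1 | apply HG1]; rewrite Cmod_R, Rabs_Ropp, Rabs_right; lra. }
  (* Inside the unit disc both functions are sums of the same series, so m is positive and there is
     room to the right of -m. *)
  assert (Hm : 1 / 2 <= m).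
  { apply Hub. split; [lra|]. intros s' Hs'. apply (is_series_C_unique (fun k =>
      @scal C_AbsRing C_NormedModule (@pow_n C_AbsRing (RtoC (- s')) k) (pFq_coef a b k)));
      [apply HF1 | apply HG1]; rewrite Cmod_R, Rabs_Ropp, Rabs_right; lra. }
  assert (Hbelow : forall s, 0 <= s < m -> F (RtoC (- s)) = G (RtoC (- s))).
  { intros s Hs.
    destruct (excluded_middle_informative (F (RtoC (- s)) = G (RtoC (- s)))) as [E1|N1];
      [exact E1 | exfalso].
    enough (m <= s) by lra. apply Hlub. intros s1 [Hs1 H1].
    destruct (Rle_lt_dec s1 s) as [L|L]; [exact L|]. exfalso. apply N1, H1. lra. }
  destruct (analytic_eq_right F G (- m) m) as [r [Hr Heq]].
  - apply HF2, slit_plane_neg. lra.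
  - apply HG2, slit_plane_neg. lra.
  - lra.
  - intros v Hv. replace (- m + v) with (- (m - v)) by ring. apply Hbelow. lra.
  (* Agreement within distance r of -m puts m + r/2 into [E], against the choice of m. *)
  - enough (m + r / 2 <= m) by lra. apply Hub. split; [lra|].
    intros s' Hs'. destruct (Rlt_le_dec s' m) as [L|L]; [apply Hbelow; lra|].
    replace (- s') with (- m + (m - s')) by ring. apply Heq.
    rewrite Rabs_left1; lra.
Qed.

(** * Evaluating [pFq] by its series or by a continuation *)

Lemma pFq_series (a b : list C) (z w : C) :
  is_complex_pseries (pFq_coef a b) z w -> pFq a b z = w.
Proof.
  intros H. unfold pFq.
  destruct (epsilon_spec (inhabits (RtoC 0)) (pFq_value a b z)
              (ex_intro _ w (or_introl H))) as [H'|[H' _]].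
  - exact (is_series_C_unique _ _ _ H' H).
  - now apply H' in H.
Qed.

(** In [pFq_value] a continuation counts only where the series diverges, hence [Hdiv]. The
    continuation selected by [epsilon] may differ from [F], but not on the negative axis. *)
Lemma pFq_continued_neg (a b : list C) (F : C -> C) (y : R) :
  pFq_continuation a b F -> 0 <= y ->
  (forall v, ~ is_complex_pseries (pFq_coef a b) (RtoC (- y)) v) ->
  pFq a b (RtoC (- y)) = F (RtoC (- y)).
Proof.
  intros HF Hy Hdiv. unfold pFq.
  destruct (epsilon_spec (inhabits (RtoC 0)) (pFq_value a b (RtoC (- y)))) as [H|H].
  - exists (F (RtoC (- y))). right. split; [exact Hdiv|]. split; [now apply slit_plane_neg|].
    now exists F.
  - now apply Hdiv in H.
  - destruct H as [_ [_ [G [HG <-]]]]. now apply (pFq_continuation_unique_neg a b).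
Qed.

(** The factor by which the product of Pochhammer symbols grows from index k to k + 1. *)
Definition shifted_prod (l : list R) (k : nat) : R :=
  fold_right Rmult 1 (map (fun u => u + INR k) l).

Lemma pochhammer_prod_S (l : list R) (k : nat) :
  pochhammer_prod (map RtoC l) (S k)
  = (pochhammer_prod (map RtoC l) k * RtoC (shifted_prod l k))%C.
Proof.
  unfold pochhammer_prod, shifted_prod. induction l as [|u l IH]; simpl.
  - now rewrite Cmult_1_r.
  - simpl in IH. rewrite IH, RtoC_mult, RtoC_plus. ring.
Qed.

Lemma pochhammer_prod_neq_0 (l : list R) (k : nat) :
  (forall j, shifted_prod l j <> 0) -> pochhammer_prod (map RtoC l) k <> 0%C.
Proof.
  intros H. induction k as [|k IH].
  - replace (pochhammer_prod (map RtoC l) 0) with (RtoC 1).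
    + intros E. apply RtoC_inj in E. lra.
    + unfold pochhammer_prod. clear. induction l as [|u l IH]; simpl in *; [easy|].
      rewrite <- IH. ring.
  - rewrite pochhammer_prod_S. apply Cmult_neq_0; [exact IH|].
    intros E. apply RtoC_inj in E. now apply (H k).
Qed.

(** Hypergeometric coefficients are determined by the initial value 1 and the ratio of successive
    terms, so a closed form has only to satisfy this recurrence. *)
Lemma pFq_coef_real (a b : list R) (c : nat -> R) :
  c 0%nat = 1 ->
  (forall k, shifted_prod b k <> 0) ->
  (forall k, c (S k) * (shifted_prod b k * INR (S k)) = c k * shifted_prod a k) ->
  forall k, pFq_coef (map RtoC a) (map RtoC b) k = RtoC (c k).
Proof.
  intros H0 Hb HS k. induction k as [|k IH].
  - rewrite H0. unfold pFq_coef.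
    assert (E : forall l, pochhammer_prod (map RtoC l) 0 = RtoC 1).
    { intros l. unfold pochhammer_prod. induction l as [|u l IH]; simpl in *; [easy|].
      rewrite IH. ring. }
    rewrite !E. simpl. field.
  - assert (Hfact : RtoC (INR (fact k)) <> 0%C).
    { intros E. apply RtoC_inj in E. exact (INR_fact_neq_0 k E). }
    assert (HSk : RtoC (INR (S k)) <> 0%C).
    { intros E. apply RtoC_inj in E. revert E. apply not_0_INR. lia. }
    assert (Hbk : RtoC (shifted_prod b k) <> 0%C).
    { intros E. apply RtoC_inj in E. now apply (Hb k). }
    pose proof (pochhammer_prod_neq_0 b k Hb) as Hpb.
    replace (c (S k)) with (c k * shifted_prod a k / (shifted_prod b k * INR (S k))).
    2:{ rewrite <- HS. field. split; [apply not_0_INR; lia | apply Hb]. }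
    rewrite RtoC_div, !RtoC_mult, <- IH.
    2:{ apply Rmult_integral_contrapositive_currified; [apply Hb | apply not_0_INR; lia]. }
    unfold pFq_coef. rewrite !pochhammer_prod_S.
    change (fact (S k)) with (S k * fact k)%nat. rewrite mult_INR, RtoC_mult.
    field. repeat split; assumption.
Qed.

Lemma pFq_real (a b : list R) (c : nat -> R) (x l : R) :
  c 0%nat = 1 ->
  (forall k, shifted_prod b k <> 0) ->
  (forall k, c (S k) * (shifted_prod b k * INR (S k)) = c k * shifted_prod a k) ->
  is_pseries c x l ->
  pFq (map RtoC a) (map RtoC b) (RtoC x) = RtoC l.
Proof.
  intros H0 Hb HS Hl. apply pFq_series.
  generalize (is_complex_pseries_RtoC c x l Hl). apply is_series_ext.
  intros k. now rewrite (pFq_coef_real a b c H0 Hb HS).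
Qed.

(** * The arctangent function 2F1(1/2,1;3/2;z) on the negative axis *)

Lemma hyp2F1_atan_coef (k : nat) :
  pFq_coef [RtoC (1 / 2); RtoC 1] [RtoC (3 / 2)] k = RtoC (/ (2 * INR k + 1)).
Proof.
  (* Here (1)_k cancels k!, and (1/2)_k / (3/2)_k telescopes to 1/(2k+1). *)
  apply (pFq_coef_real [1 / 2; 1] [3 / 2] (fun k => / (2 * INR k + 1)));
    clear k; unfold shifted_prod; simpl fold_right.
  - simpl. field.
  - intros k. pose proof (pos_INR k). lra.
  - intros k. pose proof (pos_INR k). rewrite S_INR. field. lra.
Qed.

Lemma atan_continuation :
  pFq_continuation [RtoC (1 / 2); RtoC 1] [RtoC (3 / 2)] (fun z => int01 (kernel z)).
Proof.
  split.
  - intros z Hz. generalize (int01_kernel_series z Hz). apply is_series_ext.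
    intros k. now rewrite hyp2F1_atan_coef.
  - apply int01_kernel_analytic.
Qed.

(** At z = -1 the series still converges, so there [pFq] means its sum and not a continuation; the
    value is Leibniz's series. *)
Lemma leibniz_series : is_pseries (fun k => / (2 * INR k + 1)) (-1) (PI / 4).
Proof.
  apply is_pseries_R. apply is_series_Reals.
  pose proof Alt_PI_eq as E. unfold Alt_PI in E. destruct exist_PI as [l Hl].
  replace (PI / 4) with l by lra.
  intros eps Heps. destruct (Hl eps Heps) as [N HN]. exists N. intros n Hn.
  specialize (HN n Hn). erewrite sum_eq; [exact HN|].
  intros i _. unfold tg_alt, PI_tg. rewrite plus_INR, mult_INR.
  change (INR 2) with 2. change (INR 1) with 1. apply Rmult_comm.
Qed.

Lemma atan_series_diverges (y v : R) :
  1 < y -> ~ is_pseries (fun k => / (2 * INR k + 1)) (- y) v.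
Proof.
  intros Hy Hv.
  assert (Hlim : is_lim_seq (fun k => / (2 * INR k + 1) * (- y) ^ k) 0).
  { apply ex_series_lim_0. exists v. now apply is_pseries_R. }
  (* By Bernoulli y^N is at least 1 + N(y-1), and this choice gives e(2N+1) at most that, so every
     term has absolute value at least e. *)
  set (e := Rmin 1 ((y - 1) / 2)).
  assert (He : 0 < e) by (apply Rmin_glb_lt; lra).
  pose proof (Rmin_l 1 ((y - 1) / 2)) as He1. pose proof (Rmin_r 1 ((y - 1) / 2)) as He2.
  fold e in He1, He2.
  apply is_lim_seq_spec in Hlim. destruct (Hlim (mkposreal e He)) as [N HN].
  specialize (HN N (le_n N)). simpl in HN.
  pose proof (pos_INR N) as HN0.
  rewrite Rminus_0_r, Rabs_mult, <- RPow_abs, Rabs_Ropp, Rabs_inv in HN.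
  rewrite (Rabs_right y), (Rabs_right (2 * INR N + 1)) in HN by lra.
  pose proof (poly N (y - 1) ltac:(lra)) as HB.
  replace (1 + (y - 1)) with y in HB by ring.
  apply (Rmult_lt_compat_l (2 * INR N + 1)) in HN; [|lra].
  rewrite <- Rmult_assoc, Rinv_r, Rmult_1_l in HN by lra.
  nra.
Qed.

Lemma hyp2F1_atan (u : R) :
  u <> 0 ->
  hyp2F1 (RtoC (1 / 2)) (RtoC 1) (RtoC (3 / 2)) (RtoC (- u ^ 2)) = RtoC (atan u / u).
Proof.
  intros Hu. rewrite <- int01_kernel_neg by exact Hu. unfold hyp2F1.
  pose proof (pow2_ge_0 u) as Hu2.
  (* Inside the disc the integral is the sum of the series; at -1 the sum is Leibniz's; beyond, the
     series diverges and the continuation gives the value. *)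
  destruct (total_order_T (u ^ 2) 1) as [[L|E]|L].
  - apply pFq_series, atan_continuation. rewrite Cmod_R, Rabs_Ropp, Rabs_right; lra.
  - rewrite int01_kernel_neg by exact Hu. rewrite E.
    replace (atan u / u) with (PI / 4).
    2:{ destruct (Rle_lt_dec 0 u).
        - replace u with 1 by nra. rewrite atan_1. field.
        - replace u with (Ropp 1) by nra. rewrite atan_opp, atan_1. field. }
    apply pFq_series. generalize (is_complex_pseries_RtoC _ _ _ leibniz_series).
    apply is_series_ext. intros k. now rewrite hyp2F1_atan_coef.
  - apply (pFq_continued_neg _ _ _ _ atan_continuation); [lra|].
    intros v Hv. apply is_complex_pseries_real_arg in Hv. destruct Hv as [Hv _].
    apply (atan_series_diverges (u ^ 2) (Re v)); [lra|].
    revert Hv. apply is_series_ext. intros k. now rewrite hyp2F1_atan_coef.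
Qed.

(** * Finite sums and tails of power series *)

Lemma sum_range_S (f : nat -> R) (p : nat) :
  sum_range f 0 (S p) = sum_range f 0 p + f p.
Proof.
  unfold sum_range. rewrite !Nat.sub_0_r, seq_S, map_app, fold_right_app. simpl.
  generalize (f p). generalize (map f (seq 0 p)). intros l y.
  induction l as [|u l IH]; simpl; [ring|]. rewrite IH. ring.
Qed.

Lemma sum_range_1 (f : nat -> R) (p : nat) :
  sum_range f 1 (p + 1) = sum_range (fun j => f (S j)) 0 p.
Proof.
  unfold sum_range. rewrite Nat.add_sub, Nat.sub_0_r, <- seq_shift, map_map.
  reflexivity.
Qed.

Lemma sum_range_scal (c : R) (f g : nat -> R) (p : nat) :
  (forall j, f j = c * g j) -> sum_range f 0 p = c * sum_range g 0 p.
Proof.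
  intros H. induction p as [|p IH].
  - unfold sum_range. simpl. ring.
  - rewrite !sum_range_S, IH, H. ring.
Qed.

Lemma is_pseries_tail (a : nat -> R) (x l : R) (p : nat) :
  x <> 0 -> is_pseries a x l ->
  is_pseries (fun k => a (p + k)%nat) x
    ((l - sum_range (fun j => a j * x ^ j) 0 p) / x ^ p).
Proof.
  intros Hx Ha. induction p as [|p IH].
  - replace ((l - sum_range (fun j => a j * x ^ j) 0 0) / x ^ 0) with l.
    + exact Ha.
    + unfold sum_range. simpl. field.
  - rewrite sum_range_S.
    apply (is_pseries_decr_1 (K := R_AbsRing) (V := R_NormedModule) _ x (/ x)) in IH.
    2:{ change (/ x * x = 1). now field. }
    apply is_pseries_R in IH. apply is_pseries_R.
    replace ((l - (sum_range (fun j => a j * x ^ j) 0 p + a p * x ^ p)) / x ^ S p)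
      with (/ x * ((l - sum_range (fun j => a j * x ^ j) 0 p) / x ^ p + - a (p + 0)%nat)).
    2:{ rewrite Nat.add_0_r. simpl. field. split; [now apply pow_nonzero | exact Hx]. }
    revert IH. apply is_series_ext. intros k. unfold PS_decr_1.
    now rewrite Nat.add_succ_r.
Qed.

(** * The power series of the arcsine and of its square *)

(* The coefficients k! / (3/2)_k of 2F1(1,1;3/2;x). *)
Fixpoint arc_coef (k : nat) : R :=
  match k with
  | O => 1
  | S j => arc_coef j * ((2 * INR j + 2) / (2 * INR j + 3))
  end.

Lemma arc_coef_bound (k : nat) : 0 < arc_coef k <= 1.
Proof.
  induction k as [|k IH]; simpl; [lra|]. pose proof (pos_INR k).
  assert (0 < (2 * INR k + 2) / (2 * INR k + 3) <= 1).
  { split; [apply Rdiv_lt_0_compat; lra|]. apply Rle_div_l; lra. }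
  split; [apply Rmult_lt_0_compat; lra | nra].
Qed.

Lemma arc_coef_S (k : nat) :
  arc_coef (S k) * (2 * INR k + 3) = arc_coef k * (2 * INR k + 2).
Proof. simpl. pose proof (pos_INR k). field. lra. Qed.

Lemma CV_radius_gt_of_bounded (c : nat -> R) (x : R) :
  (forall k, Rabs (c k) <= 1) -> Rabs x < 1 -> Rbar_lt (Rabs x) (CV_radius c).
Proof.
  intros Hc Hx. apply Rbar_lt_le_trans with 1; [exact Hx|].
  apply (proj1 (CV_radius_bounded c)). exists 1. intros n.
  now rewrite pow1, Rmult_1_r.
Qed.

Lemma arc_radius (x : R) : Rabs x < 1 -> Rbar_lt (Rabs x) (CV_radius arc_coef).
Proof.
  apply CV_radius_gt_of_bounded. intros k.
  pose proof (arc_coef_bound k). rewrite Rabs_right; lra.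
Qed.

(** Let E be the series and P = (E - 1)/x its shift. The recurrence (2k+3) a_(k+1) = (2k+2) a_k
    reads 2E' + P = 2E + 2xE'; eliminating P through E = 1 + xP gives the equation. *)
Lemma arc_ode (x : R) :
  Rabs x < 1 ->
  (1 - 2 * x) * PSeries arc_coef x
    + 2 * x * (1 - x) * PSeries (PS_derive arc_coef) x = 1.
Proof.
  intros Hx. pose proof (arc_radius x Hx) as Hr.
  pose proof (CV_radius_inside _ _ Hr) as Ha.
  pose proof (ex_pseries_derive _ _ Hr) as Hd.
  assert (Hdecr : ex_pseries (PS_decr_1 arc_coef) x).
  { apply CV_radius_inside. now rewrite CV_radius_decr_1. }
  pose proof (PSeries_decr_1 arc_coef x Ha) as H1. simpl (arc_coef 0) in H1.
  assert (H2 : 2 * PSeries (PS_derive arc_coef) x + PSeries (PS_decr_1 arc_coef) x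
             = 2 * PSeries arc_coef x + 2 * (x * PSeries (PS_derive arc_coef) x)).
  { rewrite <- PSeries_incr_1, <- !PSeries_scal, <- !PSeries_plus.
    - apply PSeries_ext. intros k.
      unfold PS_plus, PS_scal, PS_derive, PS_decr_1, PS_incr_1.
      change (2 * (INR (S k) * arc_coef (S k)) + arc_coef (S k)
              = 2 * arc_coef k
                + 2 * match k with 0%nat => 0 | S n => INR (S n) * arc_coef (S n) end).
      (* The shifted series has coefficient 0 at index 0, which is also the value of k a_k there. *)
      replace (match k with 0%nat => 0 | S n => INR (S n) * arc_coef (S n) end)
        with (INR k * arc_coef k) by (destruct k; [simpl; ring | reflexivity]).
      pose proof (arc_coef_S k). rewrite S_INR. lra.
    - apply ex_pseries_scal; [apply Rmult_comm | exact Ha].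
    - apply ex_pseries_scal; [apply Rmult_comm|]. now apply ex_pseries_incr_1.
    - apply ex_pseries_scal; [apply Rmult_comm | exact Hd].
    - exact Hdecr. }
  set (E := PSeries arc_coef x) in *. set (D := PSeries (PS_derive arc_coef) x) in *.
  set (P := PSeries (PS_decr_1 arc_coef) x) in *.
  replace P with (2 * E + 2 * (x * D) - 2 * D) in H1 by lra. lra.
Qed.

Lemma const_on_unit_interval (f : R -> R) (t : R) :
  (forall s, -1 < s < 1 -> is_derive f s 0) -> -1 < t < 1 -> f t = f 0.
Proof.
  intros Hf Ht.
  assert (Hin : forall s, Rmin 0 t <= s <= Rmax 0 t -> -1 < s < 1).
  { intros s. unfold Rmin, Rmax. destruct (Rle_dec 0 t); lra. }
  destruct (MVT_gen f 0 t (fun _ => 0)) as [c [_ Hc]].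
  - intros s Hs. apply Hf, Hin. lra.
  - intros s Hs. apply continuity_pt_filterlim.
    apply (ex_derive_continuous (V := R_NormedModule)). exists 0. now apply Hf, Hin.
  - lra.
Qed.

Lemma is_derive_asin (s : R) :
  -1 < s < 1 -> is_derive asin s (/ sqrt (1 - s ^ 2)).
Proof.
  intros Hs. apply is_derive_Reals. replace (/ sqrt (1 - s ^ 2)) with (1 / sqrt (1 - s²)).
  - apply derive_pt_eq_1 with (derivable_pt_asin s Hs). apply derive_pt_asin.
  - unfold Rsqr, Rdiv. rewrite Rmult_1_l. do 2 f_equal. ring.
Qed.

Lemma sqr_lt_1 (s : R) : -1 < s < 1 -> 0 < 1 - s ^ 2 /\ Rabs (s ^ 2) < 1.
Proof. intros Hs. rewrite Rabs_right by nra. nra. Qed.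

(** The differential equation at x = s^2 says exactly that the left side has derivative 1/sqrt(1 -
    s^2); both sides vanish at 0. The product form avoids a division by t. *)
Lemma arc_series_asin (t : R) :
  -1 < t < 1 -> sqrt (1 - t ^ 2) * t * PSeries arc_coef (t ^ 2) = asin t.
Proof.
  intros Ht. apply Rminus_diag_uniq.
  transitivity (sqrt (1 - 0 ^ 2) * 0 * PSeries arc_coef (0 ^ 2) - asin 0).
  2:{ rewrite asin_0. ring. }
  apply (const_on_unit_interval
    (fun s => sqrt (1 - s ^ 2) * s * PSeries arc_coef (s ^ 2) - asin s)); [|exact Ht].
  clear t Ht. intros s Hs. destruct (sqr_lt_1 s Hs) as [Hq Hx].
  pose proof (is_derive_PSeries arc_coef (s ^ 2) (arc_radius _ Hx)) as HE.
  pose proof (arc_ode (s ^ 2) Hx) as Hode.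
  pose proof (is_derive_asin s Hs) as Has.
  assert (Hq0 : 0 < sqrt (1 - s ^ 2)) by now apply sqrt_lt_R0.
  pose proof (sqrt_sqrt (1 - s ^ 2) (Rlt_le _ _ Hq)) as Hqq.
  assert (Hd1 : is_derive (fun s => sqrt (1 - s ^ 2) * s) s
            (- s * / sqrt (1 - s ^ 2) * s + sqrt (1 - s ^ 2))).
  { auto_derive; [simpl in Hq; lra|].
    replace (s * (s * 1)) with (s ^ 2) by ring. 
    change (1 + - s ^ 2) with (1 - s ^ 2). field. lra. }
  assert (Hd2 : is_derive (fun s => PSeries arc_coef (s ^ 2)) s
            (2 * s * PSeries (PS_derive arc_coef) (s ^ 2))).
  { apply (is_derive_comp (PSeries arc_coef) (fun s => s ^ 2)); [exact HE|].
    auto_derive; [exact I | ring]. }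
  pose proof (is_derive_minus _ _ _ _ _
    (is_derive_mult _ _ s _ _ Hd1 Hd2 Rmult_comm) Has) as H.
  replace 0 with (minus (plus (mult (- s * / sqrt (1 - s ^ 2) * s + sqrt (1 - s ^ 2))
      (PSeries arc_coef (s ^ 2))) (mult (sqrt (1 - s ^ 2) * s)
      (2 * s * PSeries (PS_derive arc_coef) (s ^ 2)))) (/ sqrt (1 - s ^ 2))).
  { exact H. }
  unfold minus, plus, mult, opp; simpl minus; simpl.
  change (s * (s * 1)) with (s ^ 2) in *.
  set (E := PSeries arc_coef (s ^ 2)) in *. set (D := PSeries (PS_derive arc_coef) (s ^ 2)) in *.
  set (q := sqrt (1 - s ^ 2)) in *.
  (* After multiplication by q, the relation q^2 = 1 - s^2 leaves the differential equation
     itself. *)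
  apply (Rmult_eq_reg_l q); [|lra].
  transitivity (- s ^ 2 * E + (q * q) * E + 2 * s ^ 2 * (q * q) * D - 1).
  { field. lra. }
  rewrite Hqq. lra.
Qed.

(** Both sides have derivative 2 s E(s^2), since (asin s)/sqrt(1 - s^2) = s E(s^2) by the previous
    series. *)
Lemma arc_series_asin_sqr (t : R) :
  -1 < t < 1 -> PSeries (PS_Int arc_coef) (t ^ 2) = asin t ^ 2.
Proof.
  intros Ht. apply Rminus_diag_uniq.
  transitivity (PSeries (PS_Int arc_coef) (0 ^ 2) - asin 0 ^ 2).
  2:{ rewrite asin_0, pow_i, PSeries_0 by lia. simpl. ring. }
  apply (const_on_unit_interval
    (fun s => PSeries (PS_Int arc_coef) (s ^ 2) - asin s ^ 2)); [|exact Ht].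
  clear t Ht. intros s Hs. destruct (sqr_lt_1 s Hs) as [Hq Hx].
  assert (HE : is_derive (PSeries (PS_Int arc_coef)) (s ^ 2) (PSeries arc_coef (s ^ 2))).
  { replace (PSeries arc_coef (s ^ 2))
      with (PSeries (PS_derive (PS_Int arc_coef)) (s ^ 2)).
    - apply is_derive_PSeries. rewrite CV_radius_Int. now apply arc_radius.
    - apply PSeries_ext. intros k. unfold PS_derive, PS_Int. field.
      apply not_0_INR. lia. }
  assert (Hq0 : 0 < sqrt (1 - s ^ 2)) by now apply sqrt_lt_R0.
  assert (Hd1 : is_derive (fun s => PSeries (PS_Int arc_coef) (s ^ 2)) s
            (2 * s * PSeries arc_coef (s ^ 2))).
  { apply (is_derive_comp (PSeries (PS_Int arc_coef)) (fun s => s ^ 2)); [exact HE|].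
    auto_derive; [exact I | ring]. }
  assert (Hd2 : is_derive (fun s => asin s ^ 2) s
            (2 * s * PSeries arc_coef (s ^ 2))).
  { replace (2 * s * PSeries arc_coef (s ^ 2))
      with (INR 2 * / sqrt (1 - s ^ 2) * asin s ^ pred 2).
    - apply is_derive_pow. now apply is_derive_asin.
    - rewrite <- (arc_series_asin s Hs). simpl pred. change (INR 2) with 2. rewrite pow_1.
      field. lra. }
  pose proof (is_derive_minus _ _ _ _ _ Hd1 Hd2) as H. rewrite minus_eq_zero in H. exact H.
Qed.

(** * Central binomials and the hypergeometric coefficients *)

Lemma central_binomial (j : nat) :
  Binomial.C (2 * j) j * ((2 * INR j + 1) * arc_coef j) = 4 ^ j.
Proof.
  induction j as [|j IH].
  - unfold Binomial.C. simpl. field.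
  (* The ratio of consecutive central binomials; its factors cancel against the recurrence of
     [arc_coef]. *)
  - assert (E : Binomial.C (2 * S j) (S j)
              = Binomial.C (2 * j) j * (2 * (2 * INR j + 1) / (INR j + 1))).
    { unfold Binomial.C. replace (2 * S j - S j)%nat with (S j) by lia.
      replace (2 * j - j)%nat with j by lia. replace (2 * S j)%nat with (S (S (2 * j))) by lia.
      rewrite !fact_simpl, !mult_INR, !S_INR, mult_INR. change (INR 2) with 2.
      pose proof (INR_fact_neq_0 j). pose proof (pos_INR j). field. split; [lra | assumption]. }
    pose proof (pos_INR j). rewrite E, S_INR.
    replace (2 * (INR j + 1) + 1) with (2 * INR j + 3) by ring.
    rewrite (Rmult_comm (2 * INR j + 3)), arc_coef_S.
    change (4 ^ S j) with (4 * 4 ^ j). rewrite <- IH. field. lra.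
Qed.

Lemma sum_range_head (f : nat -> R) (p : nat) :
  sum_range f 0 (S p) = f 0%nat + sum_range f 1 (p + 1).
Proof. unfold sum_range. now rewrite Nat.add_sub. Qed.

Lemma is_pseries_scal_R (c : R) (a : nat -> R) (x l : R) :
  is_pseries a x l -> is_pseries (fun k => c * a k) x (c * l).
Proof.
  intros H. apply (is_pseries_scal (V := R_NormedModule) c a x l); [apply Rmult_comm|exact H].
Qed.

Lemma hyp2F1_shifted (p : nat) (x l : R) :
  x <> 0 -> is_pseries arc_coef x l ->
  hyp2F1 (RtoC 1) (RtoC (INR (S p))) (RtoC (INR (S p) + 1 / 2)) (RtoC x)
  = RtoC (/ arc_coef p * ((l - sum_range (fun j => arc_coef j * x ^ j) 0 p) / x ^ p)).
Proof.
  intros Hx Hl. pose proof (arc_coef_bound p).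
  apply (pFq_real [1; INR (S p)] [INR (S p) + 1 / 2]
    (fun k => / arc_coef p * arc_coef (p + k))).
  - rewrite Nat.add_0_r. field. lra.
  - intros k. unfold shifted_prod; cbn [map fold_right].
    pose proof (pos_INR (S p)). pose proof (pos_INR k). lra.
  - intros k. unfold shifted_prod; cbn [map fold_right].
    pose proof (arc_coef_S (p + k)) as Hr. rewrite plus_INR in Hr.
    rewrite Nat.add_succ_r. rewrite !S_INR.
    transitivity (/ arc_coef p * ((arc_coef (S (p + k)) * (2 * (INR p + INR k) + 3))
      * (INR k + 1) / 2)); [field; lra|].
    rewrite Hr. field. lra.
  - apply is_pseries_scal_R. now apply is_pseries_tail.
Qed.

(** With n = p + 1, the extra quotient (n)_k/(n+1)_k equals n/(n+k), the divisor produced by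
    termwise integration. [PS_Int] moves indices up by one, so the tail starts at n instead of p. *)
Lemma hyp3F2_shifted (p : nat) (x l : R) :
  x <> 0 -> is_pseries (PS_Int arc_coef) x l ->
  hyp3F2 (RtoC 1) (RtoC (INR (S p))) (RtoC (INR (S p)))
    (RtoC (INR (S p) + 1 / 2)) (RtoC (INR (S p) + 1)) (RtoC x)
  = RtoC (INR (S p) / arc_coef p
      * ((l - sum_range (fun j => PS_Int arc_coef j * x ^ j) 0 (S p)) / x ^ S p)).
Proof.
  intros Hx Hl. pose proof (arc_coef_bound p). pose proof (pos_INR p).
  apply (pFq_real [1; INR (S p); INR (S p)] [INR (S p) + 1 / 2; INR (S p) + 1]
    (fun k => INR (S p) / arc_coef p * PS_Int arc_coef (S p + k))).
  - rewrite Nat.add_0_r. unfold PS_Int. rewrite S_INR. field. lra.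
  - intros k. unfold shifted_prod; cbn [map fold_right].
    rewrite S_INR. pose proof (pos_INR k).
    apply Rgt_not_eq, Rmult_lt_0_compat; lra.
  - intros k. unfold shifted_prod; cbn [map fold_right].
    pose proof (arc_coef_S (p + k)) as Hr. rewrite plus_INR in Hr.
    rewrite Nat.add_succ_r. rewrite Nat.add_succ_l.
    change (PS_Int arc_coef (S (S (p + k)))) with (arc_coef (S (p + k)) / INR (S (S (p + k)))).
    change (PS_Int arc_coef (S (p + k))) with (arc_coef (p + k) / INR (S (p + k))).
    rewrite !S_INR, !plus_INR. pose proof (pos_INR k).
    transitivity ((INR p + 1) / arc_coef p
      * ((arc_coef (S (p + k)) * (2 * (INR p + INR k) + 3)) * (INR k + 1) / 2)); [field; lra|].
    rewrite Hr. field. lra.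
  - apply is_pseries_scal_R. now apply is_pseries_tail.
Qed.

(** The coefficients of 3F2(1,1,n;3/2,n+1;x) for n = p + 1: [arc_coef k] is k!/(3/2)_k and the
    fraction is (n)_k/(n+1)_k. *)
Definition sum_coef (p k : nat) : R :=
  arc_coef k * (INR (S p) / (INR (S p) + INR k)).

Lemma sum_coef_bound (p k : nat) : Rabs (sum_coef p k) <= 1.
Proof.
  unfold sum_coef. pose proof (arc_coef_bound k). rewrite S_INR.
  pose proof (pos_INR p). pose proof (pos_INR k).
  assert (0 < (INR p + 1) / (INR p + 1 + INR k) <= 1).
  { split; [apply Rdiv_lt_0_compat; lra|]. apply Rle_div_l; lra. }
  rewrite Rabs_right; nra.
Qed.

Lemma hyp3F2_sum_coef (p : nat) (x : R) :
  Rabs x < 1 ->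
  hyp3F2 (RtoC 1) (RtoC 1) (RtoC (INR (S p))) (RtoC (3 / 2)) (RtoC (INR (S p) + 1)) (RtoC x)
  = RtoC (PSeries (sum_coef p) x).
Proof.
  intros Hx. pose proof (pos_INR p).
  apply (pFq_real [1; 1; INR (S p)] [3 / 2; INR (S p) + 1] (sum_coef p)).
  - unfold sum_coef. rewrite S_INR. simpl. field. lra.
  - intros k. unfold shifted_prod; cbn [map fold_right].
    rewrite S_INR. pose proof (pos_INR k).
    apply Rgt_not_eq, Rmult_lt_0_compat; lra.
  - intros k. unfold shifted_prod, sum_coef; cbn [map fold_right].
    pose proof (arc_coef_S k) as Hr. rewrite !S_INR. pose proof (pos_INR k).
    transitivity ((arc_coef (S k) * (2 * INR k + 3)) * ((INR p + 1) * (INR k + 1) / 2));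
      [field; lra|].
    rewrite Hr. field. lra.
  - apply PSeries_correct, CV_radius_inside, CV_radius_gt_of_bounded; [|exact Hx].
    apply sum_coef_bound.
Qed.

(** * The series and finite sums of the arcsine identity *)

Lemma central_binomial_arc (j : nat) :
  Binomial.C (2 * j) j = 4 ^ j / ((2 * INR j + 1) * arc_coef j).
Proof.
  rewrite <- central_binomial. pose proof (arc_coef_bound j). pose proof (pos_INR j).
  field. lra.
Qed.

Lemma pow_double (t : R) (j : nat) : (2 * t) ^ (2 * j) = 4 ^ j * (t ^ 2) ^ j.
Proof. rewrite pow_mult, <- Rpow_mult_distr. f_equal. ring. Qed.

(** The binomial formula at index k + 1 yields (2k+3) a_(k+1), which the recurrence lowers to (2k+2)
    a_k. *)
Lemma reciprocal_binomial_term (t : R) (k : nat) :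
  (2 * t) ^ (2 * S k) / Binomial.C (2 * S k) (S k)
  = 2 * (INR k + 1) * arc_coef k * (t ^ 2) ^ S k.
Proof.
  rewrite pow_double, central_binomial_arc, S_INR.
  pose proof (arc_coef_S k) as Hr. pose proof (arc_coef_bound (S k)). pose proof (pos_INR k).
  assert (4 ^ S k <> 0) by (apply pow_nonzero; lra).
  transitivity ((arc_coef (S k) * (2 * INR k + 3)) * (t ^ 2) ^ S k); [field; lra|].
  rewrite Hr. ring.
Qed.

(** Here 2(i+1) + 2p = 2(n+i) with n = p + 1, so the i-th term reduces to a_i x^(i+1)/(n+i), that is
    x/n times the 3F2 term. *)
Lemma binomial_series (p : nat) (t : R) :
  -1 < t < 1 ->
  is_series (fun i : nat => (2 * t) ^ (2 * S i)
      / (Binomial.C (2 * S i) (S i) * INR (S i) * INR (2 * S i + 2 * p)))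
    (t ^ 2 / INR (S p) * PSeries (sum_coef p) (t ^ 2)).
Proof.
  intros Ht. destruct (sqr_lt_1 t Ht) as [_ Hx].
  assert (H : is_pseries (sum_coef p) (t ^ 2) (PSeries (sum_coef p) (t ^ 2))).
  { apply PSeries_correct, CV_radius_inside, CV_radius_gt_of_bounded; [|exact Hx].
    apply sum_coef_bound. }
  apply is_pseries_R in H.
  apply (is_series_scal (V := R_NormedModule) (t ^ 2 / INR (S p))) in H.
  revert H. apply is_series_ext. intros i.
  change (t ^ 2 / INR (S p) * (sum_coef p i * (t ^ 2) ^ i)
    = (2 * t) ^ (2 * S i) / (Binomial.C (2 * S i) (S i) * INR (S i) * INR (2 * S i + 2 * p))).
  assert (HC : Binomial.C (2 * S i) (S i) <> 0).
  { intros E. pose proof (central_binomial (S i)) as HC. rewrite E, Rmult_0_l in HC.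
    symmetry in HC. revert HC. apply pow_nonzero. lra. }
  pose proof (pos_INR i). pose proof (pos_INR p).
  rewrite plus_INR, !mult_INR, !S_INR. change (INR 0) with 0.
  transitivity ((2 * t) ^ (2 * S i) / Binomial.C (2 * S i) (S i)
     / ((INR i + 1) * (2 * (INR i + 1) + 2 * INR p))).
  - rewrite reciprocal_binomial_term. unfold sum_coef. rewrite S_INR. simpl. field. lra.
  - field. repeat split; try lra; try exact HC.
Qed.

Lemma odd_sum_arc (p : nat) (t : R) :
  sum_range (fun j => (2 * t) ^ (2 * j + 1) / (Binomial.C (2 * j) j * INR (2 * j + 1))) 0 p
  = 2 * t * sum_range (fun j => arc_coef j * (t ^ 2) ^ j) 0 p.
Proof.
  apply sum_range_scal. intros j.
  rewrite pow_add, pow_1, pow_double, central_binomial_arc, plus_INR, mult_INR.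
  change (INR 2) with 2. change (INR 1) with 1.
  pose proof (arc_coef_bound j). pose proof (pos_INR j).
  assert (4 ^ j <> 0) by (apply pow_nonzero; lra).
  field. lra.
Qed.

Lemma even_sum_arc (p : nat) (t : R) :
  sum_range (fun j => (2 * t) ^ (2 * j) / (Binomial.C (2 * j) j * INR j ^ 2)) 1 (p + 1)
  = 2 * sum_range (fun j => PS_Int arc_coef j * (t ^ 2) ^ j) 0 (S p).
Proof.
  (* The term at index 0 of the right-hand sum vanishes because an integrated series has no constant
     term. *)
  rewrite sum_range_head, sum_range_1. simpl (PS_Int arc_coef 0). rewrite Rmult_0_l, Rplus_0_l.
  rewrite sum_range_1. apply sum_range_scal. intros j.
  pose proof (pos_INR j).
  assert (HC : Binomial.C (2 * S j) (S j) <> 0).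
  { intros E. pose proof (central_binomial (S j)) as HC. rewrite E, Rmult_0_l in HC.
    symmetry in HC. revert HC. apply pow_nonzero. lra. }
  transitivity ((2 * t) ^ (2 * S j) / Binomial.C (2 * S j) (S j) / INR (S j) ^ 2).
  - field. split; [exact HC | apply not_0_INR; lia].
  - rewrite reciprocal_binomial_term. unfold PS_Int. rewrite S_INR. field. lra.
Qed.

(** Put u = t/sqrt(1 - t^2): then t^2/(t^2 - 1) = -u^2 and asin t = atan u. *)
Lemma hyp2F1_asin (t : R) :
  -1 < t < 1 -> t <> 0 ->
  hyp2F1 (RtoC (1 / 2)) (RtoC 1) (RtoC (3 / 2)) (RtoC (t ^ 2 / (t ^ 2 - 1)))
  = RtoC (asin t * sqrt (1 - t ^ 2) / t).
Proof.
  intros Ht Ht0. destruct (sqr_lt_1 t Ht) as [Hq _].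
  pose proof (sqrt_lt_R0 _ Hq) as Hq0.
  pose proof (sqrt_sqrt (1 - t ^ 2) (Rlt_le _ _ Hq)) as Hqq.
  replace (t ^ 2 / (t ^ 2 - 1)) with (- (t / sqrt (1 - t ^ 2)) ^ 2).
  2:{ replace ((t / sqrt (1 - t ^ 2)) ^ 2) with (t ^ 2 / (sqrt (1 - t ^ 2) * sqrt (1 - t ^ 2)))
        by (field; lra).
      rewrite Hqq. field. lra. }
  rewrite hyp2F1_atan.
  - rewrite (asin_atan t Ht). replace (t²) with (t ^ 2) by (unfold Rsqr; ring).
    f_equal. field. lra.
  - apply Rmult_integral_contrapositive_currified; [exact Ht0|].
    apply Rinv_neq_0_compat. lra.
Qed.

(** * The equivalence of the two identities *)

Theorem corollary9p2 (n : nat) (t : R) (hn : (1 <= n)%nat)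
    (ht : 0 < Rabs t < 1) :
  let m := (2 * n - 2)%nat in
  let x := t ^ 2 in
  is_series
    (fun i : nat => let k := S i in
       (2 * t) ^ (2 * k)
         / (Binomial.C (2 * k) k * INR k * INR (2 * k + m)))
    (Binomial.C m (m / 2) / (2 * t) ^ m
       * ((asin t) ^ 2
          - sqrt (1 - t ^ 2) * asin t
            * sum_range (fun j => (2 * t) ^ (2 * j + 1)
                / (Binomial.C (2 * j) j * INR (2 * j + 1))) 0 (m / 2)
          + 1 / 2
            * sum_range (fun j => (2 * t) ^ (2 * j)
                / (Binomial.C (2 * j) j * INR j ^ 2)) 1 (m / 2 + 1)))
  <->
  (RtoC (2 * INR n - 1)
     * hyp3F2 (RtoC 1) (RtoC 1) (RtoC (INR n))
              (RtoC (3 / 2)) (RtoC (INR n + 1)) (RtoC x)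
   + hyp3F2 (RtoC 1) (RtoC (INR n)) (RtoC (INR n))
            (RtoC (INR n + 1 / 2)) (RtoC (INR n + 1)) (RtoC x)
   = RtoC (2 * INR n)
     * hyp2F1 (RtoC (1 / 2)) (RtoC 1) (RtoC (3 / 2)) (RtoC (x / (x - 1)))
     * hyp2F1 (RtoC 1) (RtoC (INR n)) (RtoC (INR n + 1 / 2)) (RtoC x))%C.
Proof.
  (* With n = p + 1 the truncated subtraction is exact: m = 2p and m/2 = p. *)
  destruct n as [|p]; [lia|]. intros m x.
  replace m with (2 * p)%nat by lia. clear m.
  replace (2 * p / 2)%nat with p by (rewrite Nat.mul_comm, Nat.div_mul; lia).
  assert (Ht : -1 < t < 1) by (apply Rabs_lt_between; lra).
  assert (Ht0 : t <> 0) by (intros E; rewrite E, Rabs_R0 in ht; lra).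
  destruct (sqr_lt_1 t Ht) as [Hq Hx]. fold x in Hq, Hx.
  assert (Hx0 : x <> 0) by (now apply pow_nonzero).
  pose proof (sqrt_lt_R0 _ Hq) as Hq0.
  pose proof (arc_radius x Hx) as Hr.
  pose proof (arc_series_asin t Ht) as HE. fold x in HE.
  rewrite hyp3F2_sum_coef by exact Hx.
  rewrite (hyp3F2_shifted p x (asin t ^ 2)); [| exact Hx0 |].
  2:{ rewrite <- (arc_series_asin_sqr t Ht). apply PSeries_correct, CV_radius_inside.
      now rewrite CV_radius_Int. }
  rewrite (hyp2F1_shifted p x (PSeries arc_coef x)); [| exact Hx0 |].
  2:{ now apply PSeries_correct, CV_radius_inside. }
  pose proof (hyp2F1_asin t Ht Ht0) as HA. fold x in HA. rewrite HA.
  rewrite odd_sum_arc, even_sum_arc, central_binomial_arc, pow_double. fold x.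
  rewrite <- !RtoC_mult, <- RtoC_plus.
  pose proof (binomial_series p t Ht) as HS. fold x in HS.
  set (H := PSeries (sum_coef p) x) in *.
  set (V := _ / _ * _).
  set (SA := sum_range _ 0 p) in *. set (SB := sum_range _ 0 (S p)) in *.
  set (q := sqrt (1 - x)) in *. set (E := PSeries arc_coef x) in *.
  pose proof (arc_coef_bound p) as Ha. pose proof (pos_INR p) as Hp.
  assert (HX : x ^ p <> 0) by now apply pow_nonzero.
  assert (H4 : 4 ^ p <> 0) by (apply pow_nonzero; lra).
  (* Eliminating E leaves [asin t] as the only transcendental quantity; the product of the two 2F1
     factors then supplies its square. *)
  assert (HEq : E = asin t / (q * t)) by (rewrite <- HE; field; lra).
  (* Both statements say that the sum of the series, [x / n * H], equals [V]. *)
  transitivity (x / INR (S p) * H = V).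
  - split.
    + intros HV. apply is_series_unique in HS, HV. now rewrite <- HS, <- HV.
    + intros <-. exact HS.
  - rewrite S_INR in *.
    (* The multiplier is (2n-1) n/x: it turns x/n times H into the term (2n-1) H, and its factor
       2n-1 cancels the one in the binomial prefactor of V. *)
    match goal with |- _ <-> RtoC ?l = RtoC ?r =>
      assert (HD : l - r = (2 * INR p + 1) * (INR p + 1) / x * (x / (INR p + 1) * H - V)) end.
    { rewrite HEq. unfold V. change (x ^ S p) with (x * x ^ p).
      assert (Hxt : x = t * t) by (unfold x; ring).
      set (X := x ^ p) in *. clearbody X H SA SB q. rewrite Hxt.
      field. repeat split; lra. }
    assert (Hk : (2 * INR p + 1) * (INR p + 1) / x <> 0).
    { apply Rmult_integral_contrapositive_currified; [nra | now apply Rinv_neq_0_compat]. }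
    split.
    + intros HV. f_equal. apply Rminus_diag_uniq. rewrite HD, HV. ring.
    + intros HV. apply RtoC_inj, Rminus_diag_eq in HV. rewrite HD in HV.
      apply Rmult_integral in HV. destruct HV as [HV|HV]; [now elim Hk|lra].
Qed.
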